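(* Let $\mathcal H$ be a finite-dimensional real Hilbert space, $\mathcal A:\mathcal H\to 2^{\mathcal H}$ a maximally monotone operator that is $\mu$-strongly monotone with $\mu>0$, and $\mathcal Q:\mathcal H\to\mathcal H$ a positive definite (not necessarily symmetric) linear operator. Let $\mathcal T:=(\mathcal A+\mathcal Q)^{-1}\mathcal Q$ and $\mathcal R:=\mathcal I-\mathcal T$. Then the following hold. (i) $\mathcal T$ is $\mathcal Q$-based $\big(1+\frac{\mu}{\|\mathcal Q\|}\big)$-cocoercive, and $\mathcal R$ is $\mathcal Q^\top$-based $1$-cocoercive. (ii) If $\mathcal Q$ is symmetric positive semi-definite, then $\mathcal T\in\mathcal F^{\mathcal Q}_{\frac{\|\mathcal Q\|}{2\mu+\|\mathcal Q\|},\ \frac{2\mu+\|\mathcal Q\|}{2\mu+2\|\mathcal Q\|}}$ and $\mathcal R\in\mathcal F^{\mathcal Q}_{1,\ \frac{\|\mathcal Q\|}{2(\|\mathcal Q\|+\mu)}}$. (iii) If $\mathcal Q$ is symmetric positive semi-definite, then both $\mathcal T$ and $\mathcal R$ are $\mathcal Q$-firmly nonexpansive. (iv) If $\mathcal Q$ is symmetric positive definite, then for all $b_1,b_2\in\mathcal H$, $$\langle b_1-b_2\,|\,\mathcal Rb_1-\mathcal Rb_2\rangle_{\mathcal Q}\ \ge\ \frac{\|\mathcal Q\|+\mu}{\|\mathcal Q\|+2\mu}\,\|\mathcal Rb_1-\mathcal Rb_2\|_{\mathcal Q}^2+\frac{\mu}{\|\mathcal Q\|+2\mu}\,\|b_1-b_2\|_{\mathcal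 Q}^2 .$$
   Context: The hypothesis that $\mathcal Q$ is positive definite ($\langle\mathcal Qx|x\rangle>0$ for $x\ne0$) is in force in all four parts. $\|\mathcal Q\|$ is the operator norm and $\mathcal Q^\top$ the adjoint. For a linear operator $\mathcal P$ on $\mathcal H$: $\langle a|b\rangle_{\mathcal P}:=\langle \mathcal Pa|b\rangle$ and $\|a\|_{\mathcal P}^2:=\langle\mathcal Pa|a\rangle$. $\mathcal A$ is $\mu$-strongly monotone if $\langle u_1-u_2|b_1-b_2\rangle\ge\mu\|b_1-b_2\|^2$ whenever $u_i\in\mathcal Ab_i$. $\mathcal T=(\mathcal A+\mathcal Q)^{-1}\mathcal Q$ means: $a=\mathcal Tb$ iff $\mathcal Qb\in\mathcal Aa+\mathcal Qa$ (under these hypotheses it is single-valued with full domain). An operator $\mathcal S:\mathcal H\to\mathcal H$ is $\mathcal P$-based $\beta$-cocoercive if $\langle b_1-b_2|\mathcal Sb_1-\mathcal Sb_2\rangle_{\mathcal P}\ge\beta\|\mathcal Sb_1-\mathcal Sb_2\|_{\mathcal P}^2$ for all $b_1,b_2$. It is $\mathcal Q$-based $\xi$-Lipschitz continuous if $\|\mathcal Sb_1-\mathcal Sb_2\|_{\mathcal Q}^2\le\xi^2\|b_1-b_2\|_{\mathcal Q}^2$ for all $b_1,b_2$. For $\xi\in\,]0,+\infty[$, $\alpha\in\,]0,1[$, $\mathcal S\in\mathcal F^{\mathcal Q}_{\xi,\alpha}$ means $\mathcal S=(1-\alpha)\mathcal I+\alpha\mathcal K$ for some $\mathcal Q$-based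 $\xi$-Lipschitz continuous $\mathcal K:\mathcal H\to\mathcal H$. $\mathcal S$ is $\mathcal Q$-firmly nonexpansive if $\mathcal S\in\mathcal F^{\mathcal Q}_{1,\frac12}$. *)

(* Defs.v *)
From HB Require Import structures.
From mathcomp Require Import all_boot all_order all_algebra.
From mathcomp Require Import boolp classical_sets reals.

Set Implicit Arguments.
Unset Strict Implicit.
Unset Printing Implicit Defensive.

Import Order.TTheory GRing.Theory Num.Theory.

Local Open Scope classical_set_scope.
Local Open Scope ring_scope.

(* A finite-dimensional real Hilbert space is a vectType H over a realType R
   with a positive definite symmetric bilinear form ip : {dot H for idfun};
   completeness is automatic in finite dimension. *)

Section Hilbert.
Variables (R : realType) (H : vectType R) (ip : {dot H for idfun}).

Definition hnorm (x : H) : R := Num.sqrt (ip x x).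

Definition opnorm (Q : 'End(H)) : R :=
  sup [set hnorm (Q x) | x in [set x : H | hnorm x <= 1]].

(* The adjoint exists and is unique in finite dimension, so the default value
   of xget is never used. *)
Definition adjoint (Q : 'End(H)) : 'End(H) :=
  xget 0 [set Qt : 'End(H) | forall x y, ip (Q x) y = ip x (Qt y)].

Definition ip_of (P : 'End(H)) (a b : H) : R := ip (P a) b.

Definition sqnorm_of (P : 'End(H)) (a : H) : R := ip (P a) a.

Definition posdef (Q : 'End(H)) : Prop := forall x, x != 0 -> 0 < ip (Q x) x.

Definition possemidef (Q : 'End(H)) : Prop := forall x, 0 <= ip (Q x) x.

Definition selfadjoint (Q : 'End(H)) : Prop :=
  forall x y, ip (Q x) y = ip x (Q y).

(* Set-valued operators H -> 2^H are functions H -> set H: [A b u] means that u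
   belongs to A b. *)

Definition monotone (A : H -> set H) : Prop :=
  forall b1 b2 u1 u2, A b1 u1 -> A b2 u2 -> 0 <= ip (u1 - u2) (b1 - b2).

Definition maximally_monotone (A : H -> set H) : Prop :=
  monotone A /\
  forall B : H -> set H, monotone B ->
    (forall b, A b `<=` B b) -> forall b, B b `<=` A b.

Definition strongly_monotone (mu : R) (A : H -> set H) : Prop :=
  forall b1 b2 u1 u2, A b1 u1 -> A b2 u2 ->
    mu * hnorm (b1 - b2) ^+ 2 <= ip (u1 - u2) (b1 - b2).

Definition op_add (A : H -> set H) (Q : H -> H) : H -> set H :=
  fun a => [set u + Q a | u in A a].

Definition op_inv (A : H -> set H) : H -> set H := fun u => [set a | A a u].

Definition resolvent_rel (A : H -> set H) (Q : 'End(H)) : H -> set H :=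
  fun b => op_inv (op_add A Q) (Q b).

(* T = (A + Q)^-1 Q as a map: the value at b is the element of the set
   (A + Q)^-1 (Q b), which is a singleton when A is maximally monotone and Q is
   positive definite; 0 is a dummy value for the empty set. *)
Definition resolvent (A : H -> set H) (Q : 'End(H)) (b : H) : H :=
  xget 0 (resolvent_rel A Q b).

Definition cocoercive (P : 'End(H)) (beta : R) (S : H -> H) : Prop :=
  forall b1 b2,
    beta * sqnorm_of P (S b1 - S b2) <= ip_of P (b1 - b2) (S b1 - S b2).

Definition lipschitz (Q : 'End(H)) (xi : R) (K : H -> H) : Prop :=
  forall b1 b2,
    sqnorm_of Q (K b1 - K b2) <= xi ^+ 2 * sqnorm_of Q (b1 - b2).

Definition Fclass (Q : 'End(H)) (xi alpha : R) (S : H -> H) : Prop :=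
  [/\ 0 < xi, 0 < alpha, alpha < 1 &
    exists2 K : H -> H, lipschitz Q xi K &
      forall b, S b = (1 - alpha) *: b + alpha *: K b].

Definition firmly_nonexpansive (Q : 'End(H)) (S : H -> H) : Prop :=
  Fclass Q 1 (2^-1) S.

End Hilbert.

(* Main.v *)
Require Import Defs.
From HB Require Import structures.
From mathcomp Require Import all_boot all_order all_algebra.
From mathcomp Require Import boolp classical_sets reals.
From mathcomp Require Import finmap interval_inference.
From mathcomp Require Import convex topology normedtype numfun derive realfun.
From mathcomp Require Import ring lra.

Set Implicit Arguments.
Unset Strict Implicit.
Unset Printing Implicit Defensive.

Import Order.TTheory GRing.Theory Num.Theory.
Import numFieldNormedType.Exports.
Import passmx.

Local Open Scope classical_set_scope.
Local Open Scope ring_scope.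
Local Open Scope convex_scope.

(* Everything follows from one inequality. If [Q b_i - Q a_i] lies in [A a_i],
   strong monotonicity gives, for [a = a_1 - a_2] and [b = b_1 - b_2],
   [mu |a|^2 + <Q a | a> <= <Q b | a>], and [<Q a | a> <= |Q| |a|^2] turns this
   into cocoercivity of [T] with constant [1 + mu / |Q|]. For symmetric [Q],
   cocoercivity with constant [beta] is a quadratic inequality in [a] and [b]
   that can be rewritten as [|a - (2 beta)^-1 b|_Q <= (2 beta)^-1 |b|_Q].

   That [T] has full domain is the Debrunner-Flor extension theorem: for every
   [w] some pair [(a, w - Q a)] is monotonically related to the graph of [A].
   Each point of the graph imposes on [a] an inequality [f a <= 0] with [f]
   convex. For weights [l_i >= 0], monotonicity gives [\sum_i l_i f_i <= 0] at
   the centroid of the corresponding points, and this suffices to solve finitely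
   many of the inequalities simultaneously; since [Q] is coercive, compactness
   solves all of them. *)

Lemma subrACA (V : zmodType) (x y z t : V) : x - y - (z - t) = x - z - (y - t).
Proof. by rewrite !opprB addrACA [RHS]addrACA [- y + _]addrC. Qed.

Section ConvexSystem.

Lemma affine_ge0_at0 (R : realFieldType) (a b : R) :
  (forall t, 0 < t -> t <= 1 -> 0 <= a + t * b) -> 0 <= a.
Proof.
move=> ge0; rewrite leNgt; apply/negP => a_lt0.
have ba_gt0 : 0 < `|b| - a by rewrite subr_gt0 (lt_le_trans a_lt0).
have t_gt0 : 0 < - a / (`|b| - a) by rewrite divr_gt0 ?oppr_gt0.
have := ge0 _ t_gt0; rewrite ler_pdivrMr // mul1r lerDr normr_ge0 => /(_ isT).
apply/negP; rewrite -ltNge -(pmulr_llt0 _ ba_gt0).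
rewrite mulrDl mulrAC divfK ?gt_eqF //.
have := ler_norm b; nra.
Qed.

Lemma sqr_maxr0_le (R : realDomainType) (x y : R) :
  x <= y -> Num.max x 0 ^+ 2 <= y ^+ 2.
Proof.
case: (leP x 0) => [_ _|x_gt0 xy]; first by rewrite expr0n sqr_ge0.
by rewrite lerXn2r ?nnegrE ?(ltW x_gt0) // (le_trans (ltW x_gt0)).
Qed.

Lemma continuous_funrpos (R : realType) (T : topologicalType) (f : T -> R) :
  continuous f -> continuous f^\+.
Proof. by move=> cf x; apply: continuous_max; [exact: cf|exact: cvg_cst]. Qed.

Lemma convex_function_comp_linear (R : numFieldType) (E F : lmodType R)
    (g : {linear E -> F}) (f : F -> R) (K : set E) :
  convex_function (@setT F) f -> convex_function K (f \o g).
Proof.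
move=> fconvex t x y _ _ /=.
have -> : g ((x : convex_lmodType E) <| t |> y) =
    (g x : convex_lmodType F) <| t |> g y by rewrite linearD !linearZ.
by apply: fconvex; rewrite in_setT.
Qed.

Lemma sum_sqr_funrpos_slope_ge0 (R : realFieldType) (V : lmodType R)
    (I : finType) (K : set V) (f : I -> V -> R) (a m : V) :
    convex_set K -> (forall i, convex_function K (f i)) -> K a -> K m ->
    (forall x, K x -> \sum_i (f i)^\+ a ^+ 2 <= \sum_i (f i)^\+ x ^+ 2) ->
  0 <= \sum_i (f i)^\+ a * (f i m - (f i)^\+ a).
Proof.
move=> Kconvex fconvex /mem_set aK /mem_set mK amin.
pose l i := (f i)^\+ a.
rewrite -(@pmulr_rge0 _ 2) //.
apply: (@affine_ge0_at0 _ _ (\sum_i (f i m - l i) ^+ 2)) => t t_gt0 t_le1.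
pose x := (m : convex_lmodType V) <| Itv01 (ltW t_gt0) t_le1 |> a.
have xK : K x by exact/set_mem/Kconvex.
rewrite -(pmulr_rge0 _ t_gt0) -(lerDl (\sum_i l i ^+ 2)).
apply: le_trans (amin x xK) _.
have -> : \sum_i l i ^+ 2 + t * (2 * \sum_i l i * (f i m - l i) +
    t * \sum_i (f i m - l i) ^+ 2) = \sum_i (l i + t * (f i m - l i)) ^+ 2.
  rewrite !mulr_sumr -big_split mulr_sumr -big_split.
  by apply: eq_bigr => i _ /=; ring.
apply: ler_sum => i _; apply: sqr_maxr0_le.
have fx_le : f i x <= t * f i m + (1 - t) * f i a by exact: fconvex.
have l_ge : f i a <= l i by rewrite le_max lexx.
have : 0 <= (1 - t) * (l i - f i a) by rewrite mulr_ge0 ?subr_ge0.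
lra.
Qed.

(* Minimise [\sum_i (f i)^\+ x ^+ 2] over [K]: at a minimiser [a] where it is
   positive, moving towards the point [m] attached to the weights [(f i)^\+ a]
   would decrease it to first order. *)
Lemma convex_system_solvable (R : realType) (V : normedModType R) (I : finType)
    (K : set V) (f : I -> V -> R) :
    K !=set0 -> compact K -> convex_set K ->
    (forall i, continuous (f i)) -> (forall i, convex_function K (f i)) ->
    (forall l : I -> R, (forall i, 0 <= l i) -> 0 < \sum_i l i ->
      exists2 m, K m & \sum_i l i * f i m <= 0) ->
  exists2 a, K a & forall i, f i a <= 0.
Proof.
move=> K_neq0 Kcompact Kconvex fcont fconvex fK.
have penalty_cont : continuous (fun x => \sum_i (f i)^\+ x ^+ 2).
  apply: (continuous_big add_continuous) => i _ x.
  by apply: cvgM; exact: continuous_funrpos (fcont i) x.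
have [a /set_mem Ka amin] :=
  compact_EVT_min K_neq0 Kcompact (continuous_subspaceT penalty_cont).
exists a => // i; rewrite leNgt; apply/negP => fia_gt0.
pose l j := (f j)^\+ a.
have sum_gt0 (h : I -> R) : (forall j, 0 <= h j) -> 0 < h i -> 0 < \sum_j h j.
  by move=> h_ge0 hi_gt0; rewrite (bigD1 i) //= ltr_pwDl ?sumr_ge0.
have li_gt0 : 0 < l i by rewrite lt_max fia_gt0.
have l_gt0 := sum_gt0 l (fun j => funrpos_ge0 (f j) a) li_gt0.
have [m Km fm_le0] := fK l (fun j => funrpos_ge0 (f j) a) l_gt0.
have slope_ge0 := sum_sqr_funrpos_slope_ge0 Kconvex fconvex Ka Km
  (fun x Kx => amin x (mem_set Kx)).
have := sum_gt0 (fun j => l j ^+ 2) (fun j => sqr_ge0 _) (exprn_gt0 2 li_gt0).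
have -> : \sum_j l j ^+ 2 = \sum_j l j * f j m - \sum_j l j * (f j m - l j).
  by rewrite -sumrB; apply: eq_bigr => j _; ring.
rewrite subr_gt0 => /lt_le_trans/(_ fm_le0).
by rewrite ltNge slope_ge0.
Qed.

End ConvexSystem.

Section InnerProduct.
Variables (R : realType) (H : vectType R) (ip : {dot H for idfun}).
Implicit Types (x y : H) (Q : 'End(H)).

Definition ip_linE := (linearDl ip, linearDr ip, linearNl ip, linearNr ip,
  linearZl_LR ip, linearZr_LR ip).

Lemma ipC x y : ip x y = ip y x.
Proof. by rewrite hermC expr0 mul1r. Qed.

Lemma ip_gt0 x : (0 < ip x x) = (x != 0).
Proof.
by have [->|/neq0_dnorm_gt0->//] := eqVneq x 0; rewrite linear0l ltxx.
Qed.

Lemma ip_le0 x : (ip x x <= 0) = (x == 0).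
Proof. by rewrite leNgt ip_gt0 negbK. Qed.

Lemma ip_ge0 x : 0 <= ip x x.
Proof. by have [->|] := eqVneq x 0; rewrite ?linear0l // -ip_gt0 => /ltW. Qed.

Lemma sqr_ip_le x y : ip x y ^+ 2 <= ip x x * ip y y.
Proof.
have [->|y_neq0] := eqVneq y 0; first by rewrite !(linear0r ip) expr0n mulr0.
rewrite -subr_ge0 -(@pmulr_rge0 _ (ip y y)) ?ip_gt0 //.
have := ip_ge0 (ip y y *: x - ip x y *: y).
by rewrite !ip_linE /= (ipC y x); congr (0 <= _); ring.
Qed.

Lemma hnorm_sqr x : hnorm ip x ^+ 2 = ip x x.
Proof. by rewrite sqr_sqrtr ?ip_ge0. Qed.

Lemma hnorm_ge0 x : 0 <= hnorm ip x.
Proof. exact: sqrtr_ge0. Qed.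

Lemma hnorm0 : hnorm ip 0 = 0.
Proof. by rewrite /hnorm linear0l sqrtr0. Qed.

Lemma hnorm_gt0 x : (0 < hnorm ip x) = (x != 0).
Proof. by rewrite sqrtr_gt0 ltNge ip_le0. Qed.

Lemma hnormZ c x : hnorm ip (c *: x) = `|c| * hnorm ip x.
Proof.
by rewrite /hnorm !ip_linE /= mulrA -expr2 sqrtrM ?sqr_ge0 // sqrtr_sqr.
Qed.

Lemma norm_ip_le x y : `|ip x y| <= hnorm ip x * hnorm ip y.
Proof.
rewrite -(@ler_pXn2r _ 2) ?nnegrE ?mulr_ge0 ?hnorm_ge0 //.
by rewrite exprMn !hnorm_sqr real_normK ?num_real // sqr_ip_le.
Qed.

Lemma ip_le x y : ip x y <= hnorm ip x * hnorm ip y.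
Proof. exact: le_trans (ler_norm _) (norm_ip_le x y). Qed.

Lemma ler_hnormD x y : hnorm ip (x + y) <= hnorm ip x + hnorm ip y.
Proof.
rewrite -(@ler_pXn2r _ 2) ?nnegrE ?addr_ge0 ?hnorm_ge0 //.
rewrite sqrrD !hnorm_sqr !ip_linE /= (ipC y x).
have := ip_le x y; lra.
Qed.

Lemma ler_hnorm_sum (I : Type) (r : seq I) (F : I -> H) :
  hnorm ip (\sum_(i <- r) F i) <= \sum_(i <- r) hnorm ip (F i).
Proof.
elim: r => [|i r IHr]; first by rewrite !big_nil hnorm0.
by rewrite !big_cons (le_trans (ler_hnormD _ _)) // lerD2l.
Qed.

Local Notation n := (\dim {:H}).
Local Notation e := (vbasis {:H}).

Let e_basis : basis_of {:H} e := vbasisP {:H}.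

Definition gram : 'M[R]_n := \matrix_(i, j) ip e`_i e`_j.

Lemma ip_vecof (u v : 'rV[R]_n) :
  ip (vecof e u) (vecof e v) = (u *m gram *m v^T) 0 0.
Proof.
rewrite mxE linear_sumr; apply: eq_bigr => j _.
rewrite linearZr_LR /= mulrC linear_sumlz !mxE; congr (_ * _).
by apply: eq_bigr => i _; rewrite linearZl_LR mxE.
Qed.

Lemma gram_unit : gram \in unitmx.
Proof.
rewrite -row_free_unit; apply/inj_row_free => u uG_eq0; apply/eqP.
by rewrite -(vecof_eq0 e_basis) -ip_le0 ip_vecof uG_eq0 mul0mx mxE.
Qed.

Definition dual_vbasis (i : 'I_n) : H := vecof e (row i (invmx gram)^T).

Lemma rVof_ip x i : rVof e x 0 i = ip x (dual_vbasis i).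
Proof.
rewrite -[in RHS](rVofK e_basis x) ip_vecof tr_row trmxK.
by rewrite colE mulmxA mulmxK ?gram_unit // -colE [RHS]mxE.
Qed.

Lemma adjointP Q x y : ip (Q x) y = ip x (adjoint ip Q y).
Proof.
pose Qt := hommx e e (invmx gram *m mxof e e Q *m gram)^T.
have QtP : [set Qt : 'End(H) | forall x y, ip (Q x) y = ip x (Qt y)] Qt.
  move=> a b; rewrite hommxE // -{1}(rVofK e_basis (Q a)).
  rewrite (rVof_app e e_basis) // -[a in RHS](rVofK e_basis).
  rewrite -{1}(rVofK e_basis b) !ip_vecof.
  by rewrite trmx_mul trmxK !mulmxA mulmxK ?gram_unit.
by rewrite /adjoint; case: xgetP => [Qt' _ ->|/(_ Qt)].
Qed.

Lemma ip_ofBl Q x y z : ip_of ip Q (x - y) z = ip_of ip Q x z - ip_of ip Q y z.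
Proof. by rewrite /ip_of (linearB Q) linearBl. Qed.

Lemma ip_ofBr Q x y z : ip_of ip Q x (y - z) = ip_of ip Q x y - ip_of ip Q x z.
Proof. exact: linearBr. Qed.

Lemma ip_ofZl Q c x y : ip_of ip Q (c *: x) y = c * ip_of ip Q x y.
Proof. by rewrite /ip_of (linearZ_LR Q) linearZl_LR. Qed.

Lemma ip_ofZr Q c x y : ip_of ip Q x (c *: y) = c * ip_of ip Q x y.
Proof. exact: linearZr_LR. Qed.

Definition ip_of_linE := (ip_ofBl, ip_ofBr, ip_ofZl, ip_ofZr).

Lemma sqnorm_ofE Q x : sqnorm_of ip Q x = ip_of ip Q x x.
Proof. by []. Qed.

Lemma sqnorm_ofN Q x : sqnorm_of ip Q (- x) = sqnorm_of ip Q x.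
Proof.
by rewrite -scaleN1r !sqnorm_ofE ip_ofZl ip_ofZr mulrA mulrNN !mul1r.
Qed.

Lemma ip_of_adjoint Q x y : ip_of ip (adjoint ip Q) x y = ip_of ip Q y x.
Proof. by rewrite /ip_of ipC -adjointP. Qed.

Lemma ip_ofC Q x y : selfadjoint ip Q -> ip_of ip Q x y = ip_of ip Q y x.
Proof. by move=> Qsym; rewrite /ip_of Qsym ipC. Qed.

Lemma lfun_bounded Q : exists C, forall x, hnorm ip (Q x) <= C * hnorm ip x.
Proof.
exists (\sum_i hnorm ip (dual_vbasis i) * hnorm ip (Q e`_i)) => x.
rewrite -{1}(rVofK e_basis x) linear_sum (le_trans (ler_hnorm_sum _ _)) //.
rewrite mulr_suml; apply: ler_sum => i _.
rewrite linearZ hnormZ mulrAC ler_wpM2r ?hnorm_ge0 // rVof_ip mulrC.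
exact: norm_ip_le.
Qed.

Lemma hnorm_le_opnorm Q x : hnorm ip x <= 1 -> hnorm ip (Q x) <= opnorm ip Q.
Proof.
move=> x_le1; have [C CP] := lfun_bounded Q.
apply: ub_le_sup; last by exists x.
exists `|C| => _ [y y_le1 <-]; apply: le_trans (CP y) _.
by rewrite (le_trans (ler_norm _)) // normrM ler_piMr // ger0_norm ?hnorm_ge0.
Qed.

Lemma opnorm_ge0 Q : 0 <= opnorm ip Q.
Proof. by have := @hnorm_le_opnorm Q 0; rewrite linear0 hnorm0 => ->. Qed.

Lemma hnorm_lfun_le Q x : hnorm ip (Q x) <= opnorm ip Q * hnorm ip x.
Proof.
have [->|] := eqVneq x 0; first by rewrite linear0 hnorm0 mulr0.
rewrite -hnorm_gt0 => x_gt0; rewrite -ler_pdivrMr // mulrC.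
have inv_norm : `|(hnorm ip x)^-1| = (hnorm ip x)^-1.
  by rewrite ger0_norm // invr_ge0 ltW.
rewrite -[X in X * _]inv_norm -hnormZ -linearZ hnorm_le_opnorm //.
by rewrite hnormZ inv_norm mulVf ?gt_eqF.
Qed.

Lemma ip_lfun_le_opnorm Q x : ip (Q x) x <= opnorm ip Q * ip x x.
Proof.
rewrite -hnorm_sqr expr2 mulrA (le_trans (ip_le _ _)) //.
by rewrite ler_wpM2r ?hnorm_ge0 ?hnorm_lfun_le.
Qed.

Lemma posdef_possemidef Q : posdef ip Q -> possemidef ip Q.
Proof.
by move=> Qpos x; have [->|/Qpos/ltW//] := eqVneq x 0; rewrite (linear0r ip).
Qed.

Lemma posdef_opnorm_gt0 Q x : posdef ip Q -> x != 0 -> 0 < opnorm ip Q.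
Proof.
move=> Qpos x_neq0; rewrite -(@pmulr_lgt0 _ (ip x x)) ?ip_gt0 //.
exact: lt_le_trans (Qpos x x_neq0) (ip_lfun_le_opnorm Q x).
Qed.

Lemma continuous_sum_coordM (h : 'I_n -> 'rV[R]_n -> R) :
  (forall i, continuous (h i)) ->
  continuous (fun u : 'rV[R]_n => \sum_i u 0 i * h i u).
Proof.
move=> hcont; apply: (continuous_big add_continuous) => i _ u.
apply: (@continuousM R 'rV[R]_n (fun u => u 0 i)); last exact: hcont.
exact: coord_continuous.
Qed.

Lemma continuous_ip_vecof x : continuous (fun u => ip x (vecof e u)).
Proof.
under eq_fun do [rewrite linear_sumr; under eq_bigr do rewrite linearZr_LR /=].
by apply: continuous_sum_coordM => i; exact: cst_continuous.
Qed.

Lemma continuous_ip_lfun_vecof Q :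
  continuous (fun u => ip (Q (vecof e u)) (vecof e u)).
Proof.
have -> : (fun u => ip (Q (vecof e u)) (vecof e u)) =
    (fun u : 'rV[R]_n => \sum_i u 0 i * ip (Q e`_i) (vecof e u)).
  apply/funext => u; rewrite {1}/vecof (linear_sum Q) linear_sumlz.
  by apply: eq_bigr => i _; rewrite (linearZ_LR Q) linearZl_LR.
by apply: continuous_sum_coordM => i; exact: continuous_ip_vecof.
Qed.

Lemma continuous_hnorm_vecof : continuous (fun u => hnorm ip (vecof e u)).
Proof.
have ip_cont := @continuous_ip_lfun_vecof \1%VF.
move=> u; apply: continuous_comp; last exact: sqrt_continuous.
by move: (ip_cont u); under eq_fun do rewrite id_lfunE.
Qed.

Lemma norm_rV_le : exists C, forall u, `|u| <= C * hnorm ip (vecof e u).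
Proof.
exists (\sum_i hnorm ip (dual_vbasis i)) => u.
have sum_ge0 : 0 <= (\sum_i hnorm ip (dual_vbasis i)) * hnorm ip (vecof e u).
  by rewrite mulr_ge0 ?hnorm_ge0 // sumr_ge0 // => i _; exact: hnorm_ge0.
rewrite [leLHS]/Num.norm /= mx_normrE; apply/bigmax_leP; split=> // -[i j] _ /=.
rewrite ord1 -{1}(vecofK e_basis u) rVof_ip (le_trans (norm_ip_le _ _)) //.
rewrite mulrC ler_wpM2r ?hnorm_ge0 // (bigD1 j) //= lerDl.
by rewrite sumr_ge0 // => k _; exact: hnorm_ge0.
Qed.

Lemma closed_hnorm_bounded_compact (D : set 'rV[R]_n) M :
  closed D -> (forall u, D u -> hnorm ip (vecof e u) <= M) -> compact D.
Proof.
move=> Dclosed D_le; apply: bounded_closed_compact => //.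
have [C C_le] := norm_rV_le.
exists (`|C| * M); split=> [|r /ltW r_ge u Du]; first exact: num_real.
apply: le_trans (C_le u) _; apply: le_trans r_ge.
rewrite (le_trans (ler_wpM2r (hnorm_ge0 _) (ler_norm C))) //.
by rewrite ler_wpM2l ?D_le.
Qed.

Definition hball (M : R) : set 'rV[R]_n := [set u | hnorm ip (vecof e u) <= M].

Lemma compact_hball M : compact (hball M).
Proof.
apply: (@closed_hnorm_bounded_compact _ M) => //.
exact: preimage_closed (in1W continuous_hnorm_vecof) (@closed_le _ M).
Qed.

Lemma convex_hball M : convex_set (hball M).
Proof.
move=> u v t /set_mem /= u_le /set_mem /= v_le; apply/mem_set.
have t_ge0 : 0 <= t%:num by [].
have tC_ge0 : 0 <= 1 - t%:num by rewrite subr_ge0.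
suff : hnorm ip (vecof e (t%:num *: u + (1 - t%:num) *: v)) <= M by [].
rewrite linearD !linearZ (le_trans (ler_hnormD _ _)) // !hnormZ !ger0_norm //.
by have := lerD (ler_wpM2l t_ge0 u_le) (ler_wpM2l tC_ge0 v_le); lra.
Qed.

Lemma posdef_coercive Q : posdef ip Q ->
  exists2 c, 0 < c & forall x, c * ip x x <= ip (Q x) x.
Proof.
move=> Qpos; pose S := [set u | hnorm ip (vecof e u) = 1].
have normalized x : x != 0 -> S (rVof e ((hnorm ip x)^-1 *: x)).
  rewrite -hnorm_gt0 => x_gt0; rewrite /S /= rVofK // hnormZ normfV.
  by rewrite gtr0_norm // mulVf ?gt_eqF.
have [S0|/set0P S_neq0] := eqVneq S set0.
  exists 1 => // x; have [->|/normalized] := eqVneq x 0.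
    by rewrite !(linear0r ip) mulr0.
  by rewrite S0.
have Scompact : compact S.
  apply: (@closed_hnorm_bounded_compact _ 1) => [|u ->//].
  exact: preimage_closed (in1W continuous_hnorm_vecof) (@closed_eq _ 1).
have [u /set_mem Su umin] := compact_EVT_min S_neq0 Scompact
  (continuous_subspaceT (@continuous_ip_lfun_vecof Q)).
exists (ip (Q (vecof e u)) (vecof e u)).
  by apply: Qpos; rewrite -hnorm_gt0 Su.
move=> x; have [->|x_neq0] := eqVneq x 0; first by rewrite !(linear0r ip) mulr0.
have := umin _ (mem_set (normalized x x_neq0)).
rewrite rVofK // (linearZ_LR Q) !ip_linE /= mulrA -invfM -expr2.
by rewrite hnorm_sqr ler_pdivlMl ?ip_gt0 // mulrC.
Qed.

End InnerProduct.

Section MonotoneExtension.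
Variables (R : realType) (H : vectType R) (ip : {dot H for idfun}).
Implicit Types (A : H -> set H) (Q : 'End(H)) (p : H * H).

Local Notation n := (\dim {:H}).
Local Notation e := (vbasis {:H}).

Definition monotonically_related A a u : Prop :=
  forall y v, A y v -> 0 <= ip (u - v) (a - y).

Lemma maximally_monotone_related A a u :
  maximally_monotone ip A -> monotonically_related A a u -> A a u.
Proof.
move=> [Amon Amax] au_related.
pose B : H -> set H := fun y => A y `|` [set v | y = a /\ v = u].
apply: (Amax B) => [y1 y2 v1 v2|y v Ayv|]; [|by left|by right].
case=> [Av1|[-> ->]] [Av2|[-> ->]].
- exact: Amon Av1 Av2.
- by rewrite -opprB -[y1 - a]opprB linearNl linearNr opprK; exact: au_related.
- exact: au_related.
- by rewrite !subrr linear0l.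
Qed.

(* [gap Q w p a <= 0] says that [p] and [(a, w - Q a)] are monotonically
   related. *)
Definition gap Q w p a : R := ip (Q a + p.2 - w) (a - p.1).

Lemma gapE Q w p a :
  gap Q w p a =
  ip (Q a) a + (ip (p.2 - w - adjoint ip Q p.1) a - ip (p.2 - w) p.1).
Proof.
by rewrite /gap -addrA !ip_linE /= (ipC ip (adjoint ip Q _)) -adjointP; ring.
Qed.

Lemma continuous_gap_vecof Q w p : continuous (fun u => gap Q w p (vecof e u)).
Proof.
under eq_fun do rewrite gapE.
move=> u; apply: (@continuousD R R 'rV[R]_n).
  exact: continuous_ip_lfun_vecof.
apply: (@continuousB R R 'rV[R]_n); first exact: continuous_ip_vecof.
exact: cst_continuous.
Qed.

Lemma gap_convex Q w p :
  possemidef ip Q -> convex_function (@setT H) (gap Q w p).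
Proof.
move=> Qpos t x y _ _.
have cross_ge0 : 0 <= t%:num * (1 - t%:num) * ip (Q (x - y)) (x - y).
  by apply: mulr_ge0 (Qpos _); rewrite mulr_ge0 ?subr_ge0.
suff : gap Q w p (t%:num *: x + (1 - t%:num) *: y) <=
  t%:num * gap Q w p x + (1 - t%:num) * gap Q w p y by [].
move: t%:num cross_ge0 => r.
rewrite !gapE !(linearD Q) !(linearN Q) !(linearZ_LR Q) !ip_linE /=; lra.
Qed.

Lemma monotone_centroid_le0 (I : finType) (y v : I -> H) (l : I -> R)
    (c m : H) :
    (forall i j, 0 <= ip (v i - v j) (y i - y j)) ->
    (forall i, 0 <= l i) -> 0 < \sum_i l i ->
    (\sum_i l i) *: m = \sum_i l i *: y i ->
  \sum_i l i * ip (c + v i) (m - y i) <= 0.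
Proof.
move=> vy_mon l_ge0 l_gt0 mE; rewrite -(pmulr_rle0 _ l_gt0).
pose h i j := l i * l j * ip (c + v i) (y j - y i).
have -> : (\sum_i l i) * (\sum_i l i * ip (c + v i) (m - y i)) =
    \sum_i \sum_j h i j.
  rewrite mulr_sumr; apply: eq_bigr => i _.
  rewrite mulrCA -[X in _ * X](linearZr_LR ip) scalerBr mE scaler_suml -sumrB.
  rewrite linear_sumr mulr_sumr.
  by apply: eq_bigr => j _; rewrite -scalerBr linearZr_LR /= mulrA.
suff : \sum_i \sum_j h i j + \sum_i \sum_j h i j <= 0 by lra.
rewrite {2}exchange_big -big_split sumr_le0 // => i _ /=.
rewrite -big_split sumr_le0 // => j _ /=.
rewrite (_ : _ + _ = - (l i * l j * ip (v i - v j) (y i - y j))).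
  by rewrite oppr_le0 !mulr_ge0.
by rewrite /h !ip_linE /=; ring.
Qed.

Lemma monotone_finite_gap_le0 (I : finType) (p : I -> H * H) Q w :
    possemidef ip Q ->
    (forall i j, 0 <= ip ((p i).2 - (p j).2) ((p i).1 - (p j).1)) ->
  exists a, forall i, gap Q w (p i) a <= 0.
Proof.
move=> Qpos pmon; pose M := \sum_i hnorm ip (p i).1.
have M_ge0 : 0 <= M by rewrite sumr_ge0 // => i _; exact: hnorm_ge0.
have [|||i|i|l l_ge0 l_gt0|u _ u_le0] :=
  @convex_system_solvable _ _ _ (hball ip M)
    (fun i u => gap Q w (p i) (vecof e u)).
- by exists 0; rewrite /hball /= linear0 hnorm0.
- exact: compact_hball.
- exact: convex_hball.
- exact: continuous_gap_vecof.
- exact: convex_function_comp_linear (gap_convex _ _ Qpos).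
- pose L := \sum_i l i; pose m := L^-1 *: \sum_i l i *: (p i).1.
  have Lm : L *: m = \sum_i l i *: (p i).1.
    by rewrite scalerA mulfV ?scale1r ?gt_eqF.
  exists (rVof e m); last first.
    have := monotone_centroid_le0 (Q m - w) pmon l_ge0 l_gt0 Lm.
    congr (_ <= 0); apply: eq_bigr => i _.
    by rewrite rVofK ?vbasisP // /gap [Q m + _ - w]addrAC.
  rewrite /hball /= rVofK ?vbasisP // -(ler_pM2l l_gt0) -{1}(gtr0_norm l_gt0).
  rewrite -hnormZ Lm (le_trans (ler_hnorm_sum _ _ _)) // mulr_suml.
  apply: ler_sum => i _; rewrite hnormZ ger0_norm // ler_wpM2l //.
  by rewrite /M (bigD1 i) //= lerDl sumr_ge0 // => j _; exact: hnorm_ge0.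
by exists (vecof e u).
Qed.

Lemma gap_le0_bounded Q w p : posdef ip Q ->
  exists M, forall x, gap Q w p x <= 0 -> hnorm ip x <= M.
Proof.
move=> /posdef_coercive[c c_gt0 Q_ge]; pose z := Q p.1 + p.2 - w.
exists (hnorm ip p.1 + hnorm ip z / c) => x gap_le0; pose d := x - p.1.
suff d_le : hnorm ip d <= hnorm ip z / c.
  by rewrite -[x](subrKC p.1) (le_trans (ler_hnormD _ _ _)) ?lerD2l.
have [->|] := eqVneq d 0; first by rewrite hnorm0 divr_ge0 ?hnorm_ge0 ?ltW.
rewrite -(hnorm_gt0 ip) => d_gt0.
rewrite ler_pdivlMr // mulrC -(ler_pM2r d_gt0) -mulrA -expr2 hnorm_sqr.
have Qd_le : ip (Q d) d <= - ip z d.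
  by move: gap_le0; rewrite /gap -/d (linearB Q) !ip_linE /=; lra.
rewrite (le_trans (Q_ge d)) // (le_trans Qd_le) // (le_trans (ler_norm _)) //.
by rewrite normrN norm_ip_le.
Qed.

Lemma debrunner_flor A Q w : monotone ip A -> posdef ip Q ->
  exists a, monotonically_related A a (w - Q a).
Proof.
move=> Amon Qpos; pose graph := [set p | A p.1 p.2].
suff [a gap_le0] : exists a, forall p, graph p -> gap Q w p a <= 0.
  exists a => y v Ayv; have -> : w - Q a - v = - (Q a + v - w).
    by rewrite opprB opprD addrA.
  by rewrite linearNl oppr_ge0; exact: (gap_le0 (y, v)).
have [[p0 graph_p0]|graph0] := pselect (exists p, graph p); last first.
  by exists 0 => p graph_p; case: graph0; exists p.
pose C p := [set u | gap Q w p (vecof e u) <= 0].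
have Cclosed p : closed (C p).
  exact: preimage_closed (in1W (@continuous_gap_vecof Q w p)) (@closed_le _ 0).
have [M M_ge] := gap_le0_bounded w p0 Qpos.
have := closed_hnorm_bounded_compact (Cclosed p0) (fun u => M_ge _).
rewrite compact_In0 => /(_ _ graph (fun p => C p0 `&` C p))[|D Dgraph|u uC].
- by exists C.
- have [i j|a a_le0] := @monotone_finite_gap_le0 (p0 |` D)%fset val Q w
      (posdef_possemidef Qpos).
    have graph_val k : graph (val (k : (p0 |` D)%fset)).
      have /fset1UP[->//|/Dgraph/set_mem//] := valP k.
    exact: Amon (graph_val i) (graph_val j).
  have C_a p : p \in (p0 |` D)%fset -> C p (rVof e a).
    by move=> pD; rewrite /C /= rVofK ?vbasisP //; exact: (a_le0 [` pD]%fset).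
  by exists (rVof e a) => p pD; split; apply: C_a; rewrite ?fset1U1 ?fset1Ur.
- by exists (vecof e u) => p /uC[].
Qed.

Lemma maximally_monotone_posdef_surj A Q w :
  maximally_monotone ip A -> posdef ip Q -> exists a, A a (w - Q a).
Proof.
move=> Amax Qpos; have [a a_related] := debrunner_flor w Amax.1 Qpos.
by exists a; exact: maximally_monotone_related.
Qed.

End MonotoneExtension.

Section Cocoercive.
Variables (R : realType) (H : vectType R) (ip : {dot H for idfun}).
Variable Q : 'End(H).

(* The operator [K] with [S = (1 - alpha) I + alpha K] is forced to be
   [I + alpha^-1 (S - I)]. *)
Lemma Fclass_intro (xi alpha : R) (S : H -> H) :
    0 < xi -> 0 < alpha -> alpha < 1 ->
    (forall b1 b2, sqnorm_of ip Q (S b1 - S b2 - (1 - alpha) *: (b1 - b2)) <=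
       (alpha * xi) ^+ 2 * sqnorm_of ip Q (b1 - b2)) ->
  Fclass ip Q xi alpha S.
Proof.
move=> xi_gt0 alpha_gt0 alpha_lt1 S_le; split => //.
exists (fun b => alpha^-1 *: (S b - (1 - alpha) *: b)) => [b1 b2|b]; last first.
  by rewrite scalerA mulfV ?gt_eqF // scale1r subrKC.
rewrite -scalerBr subrACA -scalerBr sqnorm_ofE ip_ofZl ip_ofZr mulrA -expr2.
by rewrite exprVn ler_pdivrMl ?exprn_gt0 // mulrA -exprMn S_le.
Qed.

Variable S : H -> H.

Lemma cocoercive_residual :
  cocoercive ip Q 1 S -> cocoercive ip (adjoint ip Q) 1 (id \- S).
Proof.
move=> S_coco b1 b2; have := S_coco b1 b2.
rewrite /= !mul1r !sqnorm_ofE !ip_of_adjoint subrACA.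
by move: (S b1 - S b2) (b1 - b2) => d b; rewrite !ip_of_linE; lra.
Qed.

Lemma cocoercive_sqnorm_le beta b1 b2 :
    selfadjoint ip Q -> 0 < beta -> cocoercive ip Q beta S ->
  sqnorm_of ip Q (S b1 - S b2 - (2 * beta)^-1 *: (b1 - b2)) <=
  (2 * beta)^-1 ^+ 2 * sqnorm_of ip Q (b1 - b2).
Proof.
move=> Qsym beta_gt0 S_coco; have : 0 <= beta^-1 by rewrite invr_ge0 ltW.
move=> /ler_wpM2l/(_ _ _ (S_coco b1 b2)); rewrite mulKf ?gt_eqF // !sqnorm_ofE.
move: (S b1 - S b2) (b1 - b2) => d b.
by rewrite !ip_of_linE (ip_ofC d b Qsym) invfM; lra.
Qed.

Lemma cocoercive_Fclass beta :
    selfadjoint ip Q -> 2^-1 < beta -> cocoercive ip Q beta S ->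
  Fclass ip Q (2 * beta - 1)^-1 (1 - (2 * beta)^-1) S /\
  Fclass ip Q 1 (2 * beta)^-1 (id \- S).
Proof.
move=> Qsym beta_gt S_coco; have beta_gt0 : 0 < beta by lra.
have beta2_gt1 : 1 < 2 * beta by lra.
have S_le b1 b2 := cocoercive_sqnorm_le b1 b2 Qsym beta_gt0 S_coco.
have alpha_gt0 : 0 < (2 * beta)^-1 by rewrite invr_gt0 mulr_gt0.
have alpha_lt1 : (2 * beta)^-1 < 1 by rewrite invf_lt1 ?mulr_gt0.
split; apply: Fclass_intro; rewrite // ?invr_gt0 ?subr_gt0 ?gtrBl // => b1 b2.
  by rewrite subKr (_ : (1 - _) * _ = (2 * beta)^-1) ?S_le //; field; lra.
rewrite mulr1 /= subrACA; move: (S b1 - S b2) (b1 - b2) (S_le b1 b2) => d b.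
by rewrite scalerBl scale1r subrACA subrr sub0r sqnorm_ofN.
Qed.

Lemma cocoercive_firmly_nonexpansive :
    selfadjoint ip Q -> cocoercive ip Q 1 S ->
  firmly_nonexpansive ip Q S /\ firmly_nonexpansive ip Q (id \- S).
Proof.
move=> Qsym /(cocoercive_Fclass Qsym); rewrite mulr1.
have -> : 2 - 1 = 1 :> R by lra.
have -> : 1 - 2^-1 = 2^-1 :> R by lra.
by rewrite invr1; apply; rewrite invf_lt1 ?ltr1n.
Qed.

Lemma cocoercive_residual_le beta b1 b2 :
    selfadjoint ip Q -> 2^-1 < beta -> cocoercive ip Q beta S ->
  beta / (2 * beta - 1) * sqnorm_of ip Q (b1 - S b1 - (b2 - S b2))
    + (beta - 1) / (2 * beta - 1) * sqnorm_of ip Q (b1 - b2)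
  <= ip_of ip Q (b1 - b2) (b1 - S b1 - (b2 - S b2)).
Proof.
move=> Qsym beta_gt S_coco; have beta2_gt1 : 0 < 2 * beta - 1 by lra.
rewrite !(mulrAC _ (2 * beta - 1)^-1) -mulrDl ler_pdivrMr //.
have := S_coco b1 b2; rewrite subrACA !sqnorm_ofE.
move: (S b1 - S b2) (b1 - b2) => d b.
by rewrite !ip_of_linE (ip_ofC d b Qsym); lra.
Qed.

End Cocoercive.

Section Resolvent.
Variables (R : realType) (H : vectType R) (ip : {dot H for idfun}).
Variables (A : H -> set H) (Q : 'End(H)).

Local Notation T := (resolvent A Q).

Lemma resolvent_relP b a : resolvent_rel A Q b a <-> A a (Q (b - a)).
Proof.
rewrite (linearB Q) /=; split=> [[u Au <-]|Aa]; first by rewrite addrK.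
by exists (Q b - Q a); rewrite ?subrK.
Qed.

Lemma resolvent_rel_inj b a1 a2 : monotone ip A -> posdef ip Q ->
  resolvent_rel A Q b a1 -> resolvent_rel A Q b a2 -> a1 = a2.
Proof.
move=> Amon Qpos /resolvent_relP Aa1 /resolvent_relP Aa2.
apply/eqP; rewrite -subr_eq0; apply: contraT => /Qpos; rewrite ltNge => /negP[].
have := Amon _ _ _ _ Aa1 Aa2; rewrite -(linearB Q) /= subrACA subrr sub0r.
by rewrite (linearN Q) linearNl oppr_ge0.
Qed.

Hypotheses (Amax : maximally_monotone ip A) (Qpos : posdef ip Q).

Lemma resolventP a b : a = T b <-> op_add A Q a (Q b).
Proof.
have Tb : resolvent_rel A Q b (T b).
  rewrite /resolvent; case: xgetP => [a' _ //|none].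
  have [a' Aa'] := maximally_monotone_posdef_surj (Q b) Amax Qpos.
  by case: (none a'); apply/resolvent_relP; rewrite (linearB Q).
by split=> [->//|ab]; exact: resolvent_rel_inj Amax.1 Qpos ab Tb.
Qed.

Lemma resolvent_strongly_monotone mu b1 b2 : strongly_monotone ip mu A ->
  mu * hnorm ip (T b1 - T b2) ^+ 2 + sqnorm_of ip Q (T b1 - T b2) <=
  ip_of ip Q (b1 - b2) (T b1 - T b2).
Proof.
have AT b : A (T b) (Q (b - T b)) by apply/resolvent_relP/resolventP.
move=> /(_ _ _ _ _ (AT b1) (AT b2)) mu_le.
by rewrite -lerBrDr sqnorm_ofE -ip_ofBl subrACA /ip_of (linearB Q).
Qed.

Local Notation q := (opnorm ip Q).

Lemma resolvent_cocoercive mu : 0 <= mu -> strongly_monotone ip mu A ->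
  cocoercive ip Q (1 + mu / q) T.
Proof.
move=> mu_ge0 Astrong b1 b2.
apply: (le_trans _ (resolvent_strongly_monotone b1 b2 Astrong)).
rewrite hnorm_sqr mulrDl mul1r addrC lerD2r -mulrA ler_wpM2l //.
have [->|q_neq0] := eqVneq q 0; first by rewrite invr0 mul0r ip_ge0.
by rewrite ler_pdivrMl ?ip_lfun_le_opnorm // lt_def q_neq0 opnorm_ge0.
Qed.

Lemma resolvent_cocoercive1 : cocoercive ip Q 1 T.
Proof.
rewrite -[1]addr0 -[X in _ + X](mul0r q^-1); apply: resolvent_cocoercive => //.
by move=> b1 b2 u1 u2 Au1 Au2; rewrite mul0r; exact: Amax.1.
Qed.

Lemma resolvent_Fclass mu :
    (0 < \dim {:H})%N -> 0 < mu -> strongly_monotone ip mu A ->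
    selfadjoint ip Q ->
  Fclass ip Q (q / (2 * mu + q)) ((2 * mu + q) / (2 * mu + 2 * q)) T /\
  Fclass ip Q 1 (q / (2 * (q + mu))) (id \- T).
Proof.
rewrite lt0n dimv_eq0 -vpick0 => /(posdef_opnorm_gt0 Qpos) q_gt0.
move=> mu_gt0 Astrong Qsym.
have := cocoercive_Fclass Qsym _ (resolvent_cocoercive (ltW mu_gt0) Astrong).
have -> : (2 * (1 + mu / q) - 1)^-1 = q / (2 * mu + q) by field; lra.
have -> : 1 - (2 * (1 + mu / q))^-1 = (2 * mu + q) / (2 * mu + 2 * q).
  by field; lra.
have -> : (2 * (1 + mu / q))^-1 = q / (2 * (q + mu)) by field; lra.
by apply; have := divr_gt0 mu_gt0 q_gt0; lra.
Qed.

Lemma resolvent_residual_le mu b1 b2 :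
    0 < mu -> strongly_monotone ip mu A -> selfadjoint ip Q ->
  (q + mu) / (q + 2 * mu) * sqnorm_of ip Q (b1 - T b1 - (b2 - T b2))
    + mu / (q + 2 * mu) * sqnorm_of ip Q (b1 - b2)
  <= ip_of ip Q (b1 - b2) (b1 - T b1 - (b2 - T b2)).
Proof.
move=> mu_gt0 Astrong Qsym; have [->|] := eqVneq b1 b2.
  by rewrite !subrr !sqnorm_ofE -(scale0r b2) !ip_ofZl !mul0r !mulr0 addr0.
rewrite -subr_eq0 => /(posdef_opnorm_gt0 Qpos) q_gt0.
have := cocoercive_residual_le b1 b2 Qsym _
  (resolvent_cocoercive (ltW mu_gt0) Astrong).
have -> : (1 + mu / q) / (2 * (1 + mu / q) - 1) = (q + mu) / (q + 2 * mu).
  by field; lra.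
have -> : (1 + mu / q - 1) / (2 * (1 + mu / q) - 1) = mu / (q + 2 * mu).
  by field; lra.
by apply; have := divr_gt0 mu_gt0 q_gt0; lra.
Qed.

End Resolvent.

Theorem lemma2p3 (R : realType) (H : vectType R) (ip : {dot H for idfun})
    (A : H -> set H) (mu : R) (Q : 'End(H))
    (Amax : maximally_monotone ip A)
    (mu_gt0 : 0 < mu) (Astrong : strongly_monotone ip mu A)
    (Qpos : posdef ip Q) :
  let T : H -> H := resolvent A Q in
  let Rop : H -> H := fun b => b - T b in
  let q : R := opnorm ip Q in
  (* T is well defined: single-valued, with full domain *)
  (forall a b, a = T b <-> op_add A Q a (Q b)) /\
  (* (i) *)
  (cocoercive ip Q (1 + mu / q) T /\ cocoercive ip (adjoint ip Q) 1 Rop) /\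
  (* (ii); the parameters lie in the required ranges only if H is not {0} *)
  ((0 < \dim {:H})%N -> selfadjoint ip Q -> possemidef ip Q ->
    Fclass ip Q (q / (2 * mu + q)) ((2 * mu + q) / (2 * mu + 2 * q)) T /\
    Fclass ip Q 1 (q / (2 * (q + mu))) Rop) /\
  (* (iii) *)
  (selfadjoint ip Q -> possemidef ip Q ->
    firmly_nonexpansive ip Q T /\ firmly_nonexpansive ip Q Rop) /\
  (* (iv) *)
  (selfadjoint ip Q -> posdef ip Q ->
    forall b1 b2,
      (q + mu) / (q + 2 * mu) * sqnorm_of ip Q (Rop b1 - Rop b2)
        + mu / (q + 2 * mu) * sqnorm_of ip Q (b1 - b2)
      <= ip_of ip Q (b1 - b2) (Rop b1 - Rop b2)).
Proof.
move=> T Rop q.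
have T_coco1 := resolvent_cocoercive1 Amax Qpos.
split; first exact: (resolventP Amax Qpos).
split.
  split; first exact: (resolvent_cocoercive Amax Qpos (ltW mu_gt0) Astrong).
  exact: (cocoercive_residual T_coco1).
split=> [dimH Qsym _|].
  exact: (resolvent_Fclass Amax Qpos dimH mu_gt0 Astrong Qsym).
split=> [Qsym _|Qsym _ b1 b2].
  exact: (cocoercive_firmly_nonexpansive Qsym T_coco1).
exact: (resolvent_residual_le Amax Qpos b1 b2 mu_gt0 Astrong Qsym).
Qed.
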